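(* For any positive integers $n$ and $k$, the following identity of formal power series in $q$ holds: $$\sum_{\Pi\in A(n,k)} \mathrm{sgn}(\Pi)\,q^{|\Pi|}=\det\left[\widetilde{E}^{*}_{2(n+i+j)-3}(q)\right]_{i,j=1}^{k}.$$
   Context: An alternating word is a word $a_1a_2\cdots a_m$ of nonnegative integers with $a_1\ge a_2\le a_3\ge a_4\le\cdots$. A $k$-staircase alternating array $\Pi$ consists of $k$ rows of nonnegative integers, each row occupying consecutive columns of a grid, such that each row (read left to right) is an alternating word and, for $1\le i\le k-1$, the last entry of row $i+1$ lies exactly two columns to the right of the last entry of row $i$. Let $\ell_i$ be the number of entries in row $i$ and $\ell_i'=\ell_i-2i+2$. For a positive integer $n$, $\Pi$ is of order $n$ if $\{\ell_i' : 1\le i\le k\}=\{2n+1,2n+3,\ldots,2n+2k-1\}$. $A(n,k)$ is the set of $k$-staircase alternating arrays of order $n$. The permutation associated to $\Pi\in A(n,k)$ is the permutation $\sigma=\sigma_1\cdots\sigma_k$ of $\{1,\dots,k\}$ given by $\sigma_i=(\ell_i'-2n+1)/2$ (equivalently $\ell_i=2(n+i+\sigma_i)-3$). The sign is $\mathrm{sgn}(\Pi)=(-1)^{\mathrm{inv}(\sigma)}$, where $\mathrm{inv}(\sigma)=|\{(i,j):1\le i<j\le k,\ \sigma_i>\sigma_j\}|$. The weight $|\Pi|$ is the sum of all entries of $\Pi$. For a permutation $\tau=\tau_1\cdots\tau_N$ of $\{1,\dots,N\}$, $\mathrm{maj}(\tau)=\sum_{i:\,\tau_i>\tau_{i+1}}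 i$. Let $\mathrm{Ralt}_{2m+1}$ be the set of reverse alternating permutations of $\{1,\dots,2m+1\}$, i.e. permutations with $\sigma_1<\sigma_2>\sigma_3<\sigma_4>\cdots$. Let $\kappa=1\,3\,2\,5\,4\cdots(2m+1)(2m)$. For a positive integer $m$ set $$E^{*}_{2m+1}(q)=\sum_{\sigma\in \mathrm{Ralt}_{2m+1}} q^{\mathrm{maj}(\sigma^{-1}\kappa)},\qquad \widetilde{E}^{*}_{2m+1}(q)=\frac{E^{*}_{2m+1}(q)}{(1-q)(1-q^2)\cdots(1-q^{2m+1})},$$ where, by convention, $\sigma^{-1}\kappa$ denotes the permutation obtained from the word of $\sigma^{-1}$ by interchanging the values $2i$ and $2i+1$ for each $1\le i\le m$. *)

(* Defs.v *)
From HB Require Import structures.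
From mathcomp Require Export all_boot all_order all_fingroup all_algebra.
From mathcomp Require Export boolp classical_sets cardinality fsbigop.
From mathcomp Require Import functions zify.

Set Implicit Arguments.
Unset Strict Implicit.
Unset Printing Implicit Defensive.

Import Order.TTheory GRing.Theory Num.Theory.

Local Open Scope ring_scope.

Record fps (R : Type) := Fps { coef_fps : nat -> R }.

HB.instance Definition _ (R : Type) := gen_eqMixin (fps R).
HB.instance Definition _ (R : Type) := gen_choiceMixin (fps R).

Lemma fpsP (R : Type) (f g : fps R) :
  (forall n, coef_fps f n = coef_fps g n) -> f = g.
Proof.
by case: f g => [f] [g] /= fg; congr Fps; apply/funext.
Qed.

Section FpsRing.
Variable R : comUnitRingType.
Implicit Types f g h : fps R.

Definition fps0 : fps R := Fps (fun=> 0).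
Definition fps1 : fps R := Fps (fun n => (n == 0)%:R).
Definition fpsX : fps R := Fps (fun n => (n == 1)%:R).
Definition fps_opp f : fps R := Fps (fun n => - coef_fps f n).
Definition fps_add f g : fps R := Fps (fun n => coef_fps f n + coef_fps g n).
Definition fps_mul f g : fps R :=
  Fps (fun n => \sum_(i < n.+1) coef_fps f i * coef_fps g (n - i)).

Fact fps_addA : associative fps_add.
Proof. by move=> f g h; apply: fpsP => n /=; rewrite addrA. Qed.

Fact fps_addC : commutative fps_add.
Proof. by move=> f g; apply: fpsP => n /=; rewrite addrC. Qed.

Fact fps_add0 : left_id fps0 fps_add.
Proof. by move=> f; apply: fpsP => n /=; rewrite add0r. Qed.

Fact fps_addN : left_inverse fps0 fps_opp fps_add.
Proof. by move=> f; apply: fpsP => n /=; rewrite addNr. Qed.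

HB.instance Definition _ :=
  GRing.isZmodule.Build (fps R) fps_addA fps_addC fps_add0 fps_addN.

Definition fps_trunc n f : {poly R} := \poly_(i < n.+1) coef_fps f i.

Lemma coef_fps_trunc n f i :
  (i <= n)%N -> (fps_trunc n f)`_i = coef_fps f i.
Proof. by move=> le_in; rewrite coef_poly ltnS le_in. Qed.

Lemma coef_fps_mul n f g i : (i <= n)%N ->
  coef_fps (fps_mul f g) i = (fps_trunc n f * fps_trunc n g)`_i.
Proof.
move=> le_in; rewrite coefM; apply: eq_bigr => -[j /= lt_ji] _.
by rewrite !coef_fps_trunc //; lia.
Qed.

Fact fps_mulC : commutative fps_mul.
Proof.
move=> f g; apply: fpsP => n.
by rewrite !(coef_fps_mul _ _ (leqnn n)) mulrC.
Qed.

Fact fps_mulA : associative fps_mul.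
Proof.
move=> f g h; apply: fpsP => n.
transitivity (fps_trunc n f * fps_trunc n g * fps_trunc n h)`_n.
  rewrite -mulrA coefM; apply: eq_bigr => j _.
  by rewrite (@coef_fps_mul n g h) ?leq_subr // coef_fps_trunc // -ltnS.
rewrite coefM; apply: eq_bigr => j _.
by rewrite (@coef_fps_mul n f g) -1?ltnS // coef_fps_trunc // leq_subr.
Qed.

Fact fps_mul1 : left_id fps1 fps_mul.
Proof.
move=> f; apply: fpsP => n /=.
rewrite big_ord_recl /= mul1r subn0 big1 ?addr0 // => i _.
by rewrite mul0r.
Qed.

Fact fps_mulDl : left_distributive fps_mul fps_add.
Proof.
move=> f g h; apply: fpsP => n /=; rewrite -big_split /=.
by apply: eq_bigr => i _; rewrite mulrDl.
Qed.

Fact fps_oner_neq0 : fps1 != fps0.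
Proof.
by apply/eqP => /(congr1 (fun f => coef_fps f 0)) /= /eqP; rewrite oner_eq0.
Qed.

HB.instance Definition _ := GRing.Zmodule_isComNzRing.Build (fps R)
  fps_mulA fps_mulC fps_mul1 fps_mulDl fps_oner_neq0.

Lemma coef_fps0M f g : coef_fps (f * g) 0 = coef_fps f 0 * coef_fps g 0.
Proof. by rewrite /= big_ord1. Qed.

Definition fps_unit : pred (fps R) := fun f => coef_fps f 0 \is a GRing.unit.

(* [fps_inv_seq f n] lists the first [n + 1] coefficients of [1 / f]. *)
Fixpoint fps_inv_seq f n : seq R :=
  if n is n'.+1 then
    let s := fps_inv_seq f n' in
    rcons s (- (coef_fps f 0)^-1 *
               \sum_(i < n'.+1) coef_fps f i.+1 * s`_(n' - i))
  else [:: (coef_fps f 0)^-1].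

Definition fps_inv f : fps R :=
  if fps_unit f then Fps (fun n => (fps_inv_seq f n)`_n) else f.

Lemma size_fps_inv_seq f n : size (fps_inv_seq f n) = n.+1.
Proof. by elim: n => //= n IHn; rewrite size_rcons IHn. Qed.

Lemma nth_fps_inv_seq f n i : (i <= n)%N ->
  (fps_inv_seq f n)`_i = (fps_inv_seq f i)`_i.
Proof.
elim: n => [|n IHn]; first by rewrite leqn0 => /eqP->.
rewrite leq_eqVlt => /orP[/eqP-> // | lt_in].
by rewrite /= nth_rcons size_fps_inv_seq lt_in IHn.
Qed.

Fact fps_mulVr : {in fps_unit, left_inverse 1 fps_inv *%R}.
Proof.
move=> f Uf; rewrite mulrC; apply: fpsP => n.
have {}Uf : fps_unit f by exact: Uf.
rewrite /fps_inv Uf /=; case: n => [|n]; first by rewrite big_ord1 /= divrr.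
rewrite big_ord_recl subn0 /= nth_rcons size_fps_inv_seq ltnn eqxx.
rewrite mulrA mulrN divrr // mulN1r.
rewrite [X in _ + X](_ : _ = \sum_(i < n.+1)
    coef_fps f i.+1 * (fps_inv_seq f n)`_(n - i)) ?addNr //.
by apply: eq_bigr => i _; rewrite subSS [in RHS]nth_fps_inv_seq ?leq_subr.
Qed.

Fact fps_unitP f g : g * f = 1 -> fps_unit f.
Proof.
move=> /(congr1 (fun h => coef_fps h 0)); rewrite coef_fps0M /= => gf1.
by apply/unitrP; exists (coef_fps g 0); split; last rewrite mulrC.
Qed.

Fact fps_inv_out : {in [predC fps_unit], fps_inv =1 id}.
Proof.
move=> f; rewrite inE /= /fps_inv => /negP nUf.
by case: ifP => // Uf; case: nUf.
Qed.

HB.instance Definition _ := GRing.ComNzRing_hasMulInverse.Build (fps R)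
  fps_mulVr fps_unitP fps_inv_out.

End FpsRing.

Local Notation q := (fpsX int).

(* The series [\sum_(x in A) s x * q ^ (w x)] over a possibly infinite set [A].
   The inner sum is the finitely supported one of [fsbigop], which is 0 by
   convention on an infinite support; see [finite_weight_level] below. *)
Definition gen_series (T : choiceType) (A : set T) (s : T -> int) (w : T -> nat)
    : fps int :=
  Fps (fun N => \sum_(x \in [set x | A x /\ w x = N]) s x).

(* a_1 >= a_2 <= a_3 >= ...; here positions start at 0. *)
Definition alternating_word (w : seq nat) : Prop :=
  forall i, (i.+1 < size w)%N ->
    if odd i then (nth 0 w i <= nth 0 w i.+1)%N
    else (nth 0 w i.+1 <= nth 0 w i)%N.

(* A row [(c, w)] is the word [w] written in consecutive columns of the grid,
   its last entry being in column [c]. *)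
Definition placed_rows (k : nat) := {ffun 'I_k -> int * seq nat}.

(* Arrays are considered up to translation of the grid: the last entry of the
   first row is put in column 0. Rows are indexed from 0. *)
Definition staircase_alternating (k : nat) (P : placed_rows k) : Prop :=
  [/\ forall i, (P i).2 <> [::] /\ alternating_word (P i).2,
      forall i j : 'I_k, j = i.+1 :> nat -> (P j).1 = (P i).1 + 2
    & forall i : 'I_k, i = 0%N :> nat -> (P i).1 = 0].

(* l_i' = l_i - 2 i + 2 for [i] counted from 1. *)
Definition row_excess (k : nat) (P : placed_rows k) (i : 'I_k) : int :=
  (size (P i).2)%:Z - 2 * i.+1%:Z + 2.

Definition arrays_of_order (n k : nat) : set (placed_rows k) :=
  [set P | staircase_alternating P /\
           [set row_excess P i | i in [set: 'I_k]] =
           [set (2 * n + 2 * j + 1)%N%:Z | j in [set: 'I_k]]]%classic.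

(* The one-line word sigma_1 ... sigma_k, with values in {1, ..., k}. *)
Definition assoc_perm (n k : nat) (P : placed_rows k) (i : 'I_k) : int :=
  ((row_excess P i - 2 * n%:Z + 1) %/ 2)%Z.

Definition inversions (k : nat) (sigma : 'I_k -> int) : nat :=
  #|[set ij : 'I_k * 'I_k | (ij.1 < ij.2)%N && (sigma ij.2 < sigma ij.1)]|.

Definition array_sgn (n k : nat) (P : placed_rows k) : int :=
  (-1) ^+ inversions (assoc_perm n P).

Definition array_weight (k : nat) (P : placed_rows k) : nat :=
  (\sum_(i < k) sumn (P i).2)%N.

Lemma staircase_last_col (k : nat) (P : placed_rows k) (i : 'I_k) :
  staircase_alternating P -> (P i).1 = (2 * i)%N%:Z.
Proof.
case=> _ step start; case: i => i; elim: i => [|i IHi] lt_ik.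
  by rewrite start.
have lt_ik' : (i < k)%N by exact: ltnW.
by rewrite (step (Ordinal lt_ik')) // IHi /=; lia.
Qed.

Lemma leq_nth_sumn (w : seq nat) (t : nat) : (nth 0 w t <= sumn w)%N.
Proof.
elim: w t => [|a w IHw] [|t] //=; first exact: leq_addr.
by rewrite (leq_trans (IHw t)) ?leq_addl.
Qed.

Lemma finite_weight_level (n k N : nat) :
  finite_set [set P : placed_rows k |
    arrays_of_order n P /\ array_weight P = N]%classic.
Proof.
pose L := (2 * n + 4 * k)%N.
pose T := {ffun 'I_k -> 'I_L.+1 * {ffun 'I_L.+1 -> 'I_N.+1}}.
pose F (h : T) : placed_rows k :=
  [ffun i : 'I_k => ((2 * i)%N%:Z, mkseq (fun t => val ((h i).2 (inord t))) (h i).1)].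
apply: (@sub_finite_set _ _ (F @` [set: T])%classic); last first.
  exact/finite_image/finite_finset.
move=> P [[stP ordP] wP].
exists [ffun i : 'I_k => (inord (size (P i).2),
                   [ffun t : 'I_L.+1 => inord (nth 0 (P i).2 t)])] => //.
apply/ffunP => i; rewrite !ffunE /=.
rewrite [RHS]surjective_pairing (staircase_last_col i stP); congr pair.
have szP : (size (P i).2 < L.+1)%N.
  have : [set row_excess P i | i in [set: 'I_k]]%classic (row_excess P i).
    by exists i.
  rewrite ordP => -[j _]; rewrite /row_excess /L.
  have := ltn_ord i; have := ltn_ord j; lia.
apply: (@eq_from_nth _ 0%N); rewrite size_mkseq inordK // => t lt_t.
have lt_tL : (t < L.+1)%N by exact: ltn_trans lt_t szP.
rewrite nth_mkseq // ffunE inordK // inordK // ltnS -wP.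
rewrite (leq_trans (leq_nth_sumn _ t)) // /array_weight (bigD1 i) //=.
exact: leq_addr.
Qed.

(* A permutation of {1, ..., N} is an element of ['S_N]; positions and values
   are shifted down by 1. *)
Definition maj (N : nat) (t : 'S_N) : nat :=
  (\sum_(i < N | [exists j : 'I_N, (j == i.+1 :> nat) && (t j < t i)]) i.+1)%N.

Definition Ralt (m : nat) : {set 'S_(m.*2.+1)} :=
  [set s : 'S_(m.*2.+1) | [forall i : 'I_(m.*2.+1), forall j : 'I_(m.*2.+1),
     (j == i.+1 :> nat) ==> (if odd i then s j < s i else s i < s j)%N]].

(* The word 1 3 2 5 4 ... (2m+1) (2m), with letters shifted down by 1. *)
Definition kappa_fun (m : nat) (i : 'I_(m.*2.+1)) : 'I_(m.*2.+1) :=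
  inord (if odd i then i.+1 else i.-1).

Lemma kappa_funK (m : nat) : involutive (@kappa_fun m).
Proof.
move=> [i lt_i]; apply: val_inj; rewrite /kappa_fun /=.
have lt_fi : ((if odd i then i.+1 else i.-1) < m.*2.+1)%N by case: ifP; lia.
rewrite (inordK lt_fi); case: (boolP (odd i)) lt_fi => [oi | ei] lt_fi.
  by rewrite /= oi /= inordK.
case: i ei lt_i lt_fi => [|i] /= ei lt_i lt_fi; first by rewrite inordK.
by rewrite -[odd i]negbK ei inordK.
Qed.

Definition kappa (m : nat) : 'S_(m.*2.+1) :=
  perm (inv_inj (@kappa_funK m)).

(* E^*_(2m+1)(q). The product of ['S_N] composes from left to right, so that
   [s^-1 * kappa m] maps [x] to [kappa m (s^-1 x)]: it interchanges the values
   2i and 2i+1 (counted from 1) in the word of [s^-1]. *)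
Definition Estar (m : nat) : fps int :=
  \sum_(s in Ralt m) q ^+ maj (s^-1 * kappa m)%g.

Definition Estar_tilde (m : nat) : fps int :=
  Estar m / \prod_(1 <= i < m.*2.+2) (1 - q ^+ i).

(* Hence [/] in [Estar_tilde] is a true division. *)
Lemma unit_Estar_denominator (m : nat) :
  (\prod_(1 <= i < m.*2.+2) (1 - q ^+ i) : fps int) \is a GRing.unit.
Proof.
rewrite big_seq_cond; apply: (big_ind (fun f : fps int => f \is a GRing.unit)).
- exact: unitr1.
- by move=> f g Uf Ug; rewrite unitrM Uf.
case=> [|i]; rewrite andbT mem_index_iota // => _; rewrite exprS.
rewrite unfold_in /= /fps_unit.
have -> : coef_fps (1 - q * q ^+ i) 0 = 1 - coef_fps (q * q ^+ i) 0 by [].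
by rewrite coef_fps0M /= mul0r subr0 unitr1.
Qed.

(* Main.v *)
From mathcomp Require Import functions zify.
Require Import Defs.

(** The rows of a staircase array do not constrain each other: once the
    permutation [s] is known, the columns are forced, and row [i] is an
    arbitrary alternating word of length [2 (n + i + s i) + 1]. Hence, if
    [W_m] is the generating series of alternating words of length [2 m + 1] by
    the sum of their letters, the arrays with permutation [s] contribute
    [sgn s * \prod_i W_(n + i + s i)], and summing over [s] gives the Leibniz
    expansion of a determinant ([arrays_of_orderE], [gen_series_arrays_of_perm];
    the two notions of sign agree by [sign_inversions]).

    What remains is [W_m = Estar_tilde m], an instance of Stanley's theory of
    P-partitions. Fix a labelling [kap] of the [N] positions of a word. Listing
    the positions by decreasing letter, ties being broken by increasing label,
    attaches to every word a unique permutation [s] (the relation [reads]).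
    The words with a given [s] are the sequences that weakly decrease along this
    list, strictly where the labels, read along the list, have a descent.
    Subtracting the forced drops, they correspond to arbitrary sequences of [N]
    gaps ([word_of_gaps]); the gap after the first [x] positions contributes
    [x] times its value, and the forced drops contribute the major index of
    the word [s^-1 * kap] of labels. So these words have the series
    [q ^ maj (s^-1 * kap) / ((1 - q) ... (1 - q ^ N))] ([count_series_reads]).

    For [N = 2 m + 1] and [kap = kappa m], a position at which an alternating
    word is allowed to be larger has a smaller label than its neighbours, so
    that ties never violate the alternation: a word is alternating if and only
    if [s] is reverse alternating ([Ralt_reads]). Summing over [Ralt m] yields
    [Estar_tilde m]. *)

Set Implicit Arguments.
Unset Strict Implicit.
Unset Printing Implicit Defensive.
Import Order.TTheory GRing.Theory Num.Theory.
Local Open Scope ring_scope.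
Local Notation q := (fpsX int).

(** * Generating series of weighted sets *)

(** The condition under which [gen_series] is meaningful: on an infinite level
    the finitely supported sum may silently be 0. *)
Definition finite_levels (T : choiceType) (A : set T) (w : T -> nat) : Prop :=
  forall N, finite_set [set x | A x /\ w x = N]%classic.

Definition count_series (T : choiceType) (A : set T) (w : T -> nat) : fps int :=
  gen_series A (fun=> 1) w.

Lemma coef_fps_sum (I : Type) (r : seq I) (P : pred I) (F : I -> fps int) N :
  coef_fps (\sum_(i <- r | P i) F i) N = \sum_(i <- r | P i) coef_fps (F i) N.
Proof. by elim/big_rec2: _ => // i y x _ <-. Qed.

Lemma coef_fpsXM (f : fps int) N :
  coef_fps (q * f) N = if N is N'.+1 then coef_fps f N' else 0.
Proof.
case: N => [|N] /=; first by rewrite big_ord1 mul0r.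
rewrite 2!big_ord_recl /= big1 ?addr0 ?mul0r ?add0r ?mul1r ?subn1 //.
by move=> i _; rewrite mul0r.
Qed.

(** All the sums are compared with sums over the whole union, where exactly one
    index [i] contributes at each point. *)
Lemma fsum_partition (I : finType) (P : pred I) (T : choiceType)
    (B : I -> set T) (s : T -> int) :
  (forall i, P i -> finite_set (B i)) ->
  (forall i j x, P i -> P j -> B i x -> B j x -> i = j) ->
  \sum_(x \in [set x | exists2 i, P i & B i x]%classic) s x =
  \sum_(i | P i) \sum_(x \in B i) s x.
Proof.
move=> finB disjB; set X := [set x | _]%classic.
have finX : finite_set X.
  rewrite (_ : X = \bigcup_(i in [set i | P i]) B i)%classic.
    by apply: bigcup_finite => //; exact: finite_finset.
  by apply/seteqP; split=> x [i]; exists i.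
transitivity (\sum_(i | P i) \sum_(x \in X) if x \in B i then s x else 0).
  rewrite fsbig_finite //=.
  under [RHS]eq_bigr do rewrite fsbig_finite //=.
  rewrite exchange_big /= !big_seq; apply: eq_bigr => x.
  rewrite in_fset_set // inE => -[i Pi Bix].
  rewrite (bigD1 i) //= mem_set // big1 ?addr0 // => j /andP[Pj /eqP ji].
  by case: ifPn => // /set_mem Bjx; case: ji; exact: disjB Bjx Bix.
apply: eq_bigr => i Pi; rewrite -fsbig_mkcondr; apply: eq_fsbigl.
by apply/seteqP; split=> [x []//|x Bx]; split=> //; exists i.
Qed.

Lemma gen_series_partition (I : finType) (P : pred I) (T : choiceType)
    (B : I -> set T) (s : T -> int) (w : T -> nat) :
  (forall i, P i -> finite_levels (B i) w) ->
  (forall i j x, P i -> P j -> B i x -> B j x -> i = j) ->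
  gen_series [set x | exists2 i, P i & B i x]%classic s w =
  \sum_(i | P i) gen_series (B i) s w.
Proof.
move=> finB disjB; apply: fpsP => N; rewrite coef_fps_sum /=.
rewrite -fsum_partition; last 2 first.
- by move=> i Pi; exact: finB.
- by move=> i j x Pi Pj [Bi _] [Bj _]; exact: disjB Bi Bj.
apply: eq_fsbigl; apply/seteqP.
by split=> [x [[i Pi Bi] wx]|x [i Pi [Bi wx]]]; [exists i|split=> //; exists i].
Qed.

Lemma level_image (T U : choiceType) (h : T -> U) (A : set T) (w : U -> nat) N :
  ([set y | (h @` A) y /\ w y = N] = h @` [set x | A x /\ w (h x) = N])%classic.
Proof.
apply/seteqP; split=> [y [[x Ax <-] wx]|y [x [Ax wx] <-]]; first by exists x.
by split=> //; exists x.
Qed.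

Lemma finite_levels_image (T U : choiceType) (h : T -> U) (A : set T)
    (w : U -> nat) :
  finite_levels A (w \o h) -> finite_levels (h @` A)%classic w.
Proof. by move=> finA N; rewrite level_image; exact/finite_image/finA. Qed.

Lemma gen_series_image (T U : choiceType) (h : T -> U) (A : set T) s w :
  set_inj A h ->
  gen_series (h @` A)%classic s w = gen_series A (s \o h) (w \o h).
Proof.
move=> inj_h; apply: fpsP => N /=; rewrite level_image fsbig_image //.
by move=> x y /set_mem[Ax _] /set_mem[Ay _]; apply: inj_h; exact: mem_set.
Qed.

Lemma eq_gen_series (T : choiceType) (A : set T) s s' w w' :
  (forall x, A x -> s x = s' x) -> (forall x, A x -> w x = w' x) ->
  gen_series A s w = gen_series A s' w'.
Proof.
move=> ss' ww'; apply: fpsP => N /=.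
rewrite (_ : [set x | A x /\ w' x = N] = [set x | A x /\ w x = N])%classic.
  by apply: eq_fsbigr => x /set_mem[Ax _]; exact: ss'.
by apply/seteqP; split=> x [Ax <-]; split=> //; rewrite ww'.
Qed.

Lemma gen_series_sign (T : choiceType) (A : set T) (b : bool) w :
  gen_series A (fun=> (-1) ^+ b) w = (-1) ^+ b * count_series A w.
Proof.
case: b; last by rewrite mul1r.
rewrite mulN1r; apply: fpsP => N /=.
by rewrite -[RHS]mulN1r mulr_fsumr; apply: eq_fsbigr => x _; rewrite mulr1.
Qed.

Lemma finite_levels_shift (T : choiceType) (A : set T) w c :
  finite_levels A w -> finite_levels A (fun x => w x + c)%N.
Proof.
move=> finA N; apply: sub_finite_set (finA (N - c)%N) => x [Ax <-].
by rewrite /= addnK.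
Qed.

Lemma count_series_shift (T : choiceType) (A : set T) w c :
  count_series A (fun x => w x + c)%N = q ^+ c * count_series A w.
Proof.
elim: c => [|c IHc].
  by rewrite mul1r; apply: eq_gen_series => // x _; rewrite addn0.
rewrite exprS -mulrA -IHc; apply: fpsP => -[|N]; rewrite coef_fpsXM /=.
  by apply: fsbig1 => x [_] /=; rewrite addnS.
apply: eq_fsbigl; apply/seteqP; split=> x [Ax] /=; rewrite addnS => xN.
  by split=> //; case: xN.
by split=> //; rewrite xN.
Qed.

Lemma level_setX (T U : choiceType) (A : set T) (B : set U) w v N :
  ([set p | (A `*` B) p /\ (w p.1 + v p.2)%N = N] =
   [set p | exists2 i : 'I_N.+1, xpredT i &
     ([set x | A x /\ w x = i] `*` [set y | B y /\ v y = N - i]) p])%N%classic.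
Proof.
apply/seteqP; split=> [[x y] /= [[Ax By] wv]|[x y] /= [i _ [[Ax wx] [By vy]]]].
  have lt_wN : (w x < N.+1)%N by lia.
  by exists (Ordinal lt_wN) => //=; split; split=> //; lia.
by split=> //; have := ltn_ord i; lia.
Qed.

Lemma finite_levels_setX (T U : choiceType) (A : set T) (B : set U) w v :
  finite_levels A w -> finite_levels B v ->
  finite_levels (A `*` B)%classic (fun p => w p.1 + v p.2)%N.
Proof.
move=> finA finB N; rewrite level_setX.
set F := fun i : 'I_N.+1 =>
  ([set x | A x /\ w x = i] `*` [set y | B y /\ v y = N - i])%N%classic.
apply: (@sub_finite_set _ _ (\bigcup_(i in [set: 'I_N.+1]) F i)%classic).
  by move=> p [i _ Fp]; exists i.
by apply: bigcup_finite => [|i _]; [exact: finite_finset|exact: finite_setX].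
Qed.

(** The Cauchy product: a level of [A `*` B] splits according to the weight of
    the first component. *)
Lemma count_series_setX (T U : choiceType) (A : set T) (B : set U) w v :
  finite_levels A w -> finite_levels B v ->
  count_series (A `*` B)%classic (fun p => w p.1 + v p.2)%N =
  count_series A w * count_series B v.
Proof.
move=> finA finB; apply: fpsP => N /=; rewrite level_setX fsum_partition.
- apply: eq_bigr => i _; rewrite mulr_fsuml.
  under [RHS]eq_fsbigr do rewrite mulr_fsumr.
  by rewrite pair_fsbig //; apply: eq_fsbigr => p _; rewrite mulr1.
- by move=> i _; exact: finite_setX.
- move=> i j [x y] _ _ /= [[_ wi] _] [[_ wj] _].
  by apply: val_inj => /=; rewrite -wi -wj.
Qed.

Definition ffun_cons (T : Type) n (p : T * {ffun 'I_n -> T}) :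
    {ffun 'I_n.+1 -> T} :=
  [ffun i => if unlift ord0 i is Some j then p.2 j else p.1].

Lemma ffun_cons0 (T : Type) n (p : T * {ffun 'I_n -> T}) :
  ffun_cons p ord0 = p.1.
Proof. by rewrite ffunE unlift_none. Qed.

Lemma ffun_consS (T : Type) n (p : T * {ffun 'I_n -> T}) i :
  ffun_cons p (lift ord0 i) = p.2 i.
Proof. by rewrite ffunE liftK. Qed.

Lemma ffun_cons_inj (T : Type) n : injective (@ffun_cons T n).
Proof.
move=> [x f] [y g] eq_fg; congr pair.
  by have /ffunP/(_ ord0) := eq_fg; rewrite !ffun_cons0.
by apply/ffunP => i; have /ffunP/(_ (lift ord0 i)) := eq_fg;
  rewrite !ffun_consS.
Qed.

(** Induction on [n] through [ffun_cons]. Finiteness of the levels is part of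
    the induction because [count_series_setX] needs it for the tail. *)
Lemma count_series_ffun (T : choiceType) n (A : 'I_n -> set T)
    (w : 'I_n -> T -> nat) :
  (forall i, finite_levels (A i) (w i)) ->
  let E := [set f : {ffun 'I_n -> T} | forall i, A i (f i)]%classic in
  let wE := fun f : {ffun 'I_n -> T} => (\sum_(i < n) w i (f i))%N in
  finite_levels E wE /\
  count_series E wE = \prod_(i < n) count_series (A i) (w i).
Proof.
elim: n A w => [|n IHn] A w finA E wE.
  pose f0 : {ffun 'I_0 -> T} := ffun0 (card_ord 0).
  have Ef : E = [set f0]%classic.
    by apply/seteqP; split=> [f _|f _]; [apply/ffunP; case|case].
  have wE0 f : wE f = 0%N by rewrite /wE big_ord0.
  split=> [N|].
    by apply: sub_finite_set (finite_set1 f0) => f [+ _]; rewrite Ef.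
  rewrite big_ord0; apply: fpsP => -[|N] /=.
    rewrite (_ : [set x | _]%classic = E); first by rewrite Ef fsbig_set1.
    by apply/seteqP; split=> f // [].
  by apply: fsbig1 => f [_]; rewrite wE0.
have [finE' E'series] := IHn (fun i => A (lift ord0 i))
  (fun i => w (lift ord0 i)) (fun i => finA (lift ord0 i)).
set E' := [set f | _]%classic in finE' E'series.
pose wE' (f : {ffun 'I_n -> T}) := (\sum_(i < n) w (lift ord0 i) (f i))%N.
rewrite -/wE' in finE' E'series.
have EE' : (E = @ffun_cons T n @` (A ord0 `*` E'))%classic.
  apply/seteqP; split=> [f Ef|_ [p [Ap E'p] <-] i]; last first.
    by case: (unliftP ord0 i) => [j|] ->; rewrite ?ffun_consS ?ffun_cons0.
  exists (f ord0, [ffun i => f (lift ord0 i)]).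
    by split=> [|i /=]; [exact: Ef|rewrite ffunE; exact: Ef].
  by apply/ffunP => i; case: (unliftP ord0 i) => [j|] ->;
    rewrite ?ffun_consS ?ffun_cons0 //= ffunE.
have wEcons : wE \o @ffun_cons T n = fun p => (w ord0 p.1 + wE' p.2)%N.
  apply/funext => p; rewrite /wE /= big_ord_recl ffun_cons0; congr addn.
  by apply: eq_bigr => i _; rewrite ffun_consS.
rewrite EE'; split.
  apply: finite_levels_image; rewrite wEcons.
  exact: (finite_levels_setX (finA ord0) finE').
rewrite /count_series gen_series_image; last first.
  by move=> x y _ _; exact: ffun_cons_inj.
by rewrite wEcons big_ord_recl -E'series -(count_series_setX (finA ord0) finE').
Qed.

(** * The geometric series *)

Lemma finite_levels_mulnat c : (0 < c)%N ->
  finite_levels [set: nat]%classic (fun d => c * d)%N.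
Proof.
move=> c_gt0 N; apply: (@sub_finite_set _ _ `I_N.+1).
  by move=> d [_ /= <-]; rewrite /= ltnS leq_pmull.
exact: finite_II.
Qed.

Lemma unit_one_subXn c : (0 < c)%N -> (1 - q ^+ c : fps int) \is a GRing.unit.
Proof.
case: c => // c _; rewrite exprS unfold_in /= /fps_unit.
have -> : coef_fps (1 - q * q ^+ c) 0 = 1 - coef_fps (q * q ^+ c) 0 by [].
by rewrite coef_fpsXM subr0 unitr1.
Qed.

(** Splitting off [d = 0] and shifting the other values gives the fixed point
    equation [F = 1 + q ^+ c * F]. *)
Lemma count_series_mulnat c : (0 < c)%N ->
  count_series [set: nat]%classic (fun d => c * d)%N = (1 - q ^+ c)^-1.
Proof.
move=> c_gt0; set F := count_series _ _.
suff FE : F = 1 + q ^+ c * F.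
  have FI : F * (1 - q ^+ c) = 1.
    by rewrite mulrBr mulr1 [F * _]mulrC [X in X - _]FE addrK.
  by rewrite -[F](mulrK (unit_one_subXn c_gt0)) FI mul1r.
pose B b := (if b then [set 0%N] else [set d | (0 < d)%N])%classic.
have FB : F = gen_series [set d | exists2 b, xpredT b & B b d]%classic (fun=> 1)
    (fun d => c * d)%N.
  rewrite /F /count_series; congr gen_series; apply/seteqP; split=> [d _|//].
  by case: d => [|d]; [exists true|exists false].
rewrite {1}FB gen_series_partition; last 2 first.
- move=> b _ N; apply: sub_finite_set (finite_levels_mulnat c_gt0 N).
  by move=> d [_ <-].
- by move=> [] [] [|d].
rewrite big_bool /=; congr (_ + _).
  apply: fpsP => N /=; case: (eqVneq N 0%N) => [->|N0].
    rewrite (_ : [set x | _]%classic = [set 0%N]%classic) ?fsbig_set1 //.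
    by apply/seteqP; split=> [x []//|x ->]; split=> //; rewrite muln0.
  by apply: fsbig1 => x [-> N0']; move: N0; rewrite -N0' muln0 eqxx.
rewrite -count_series_shift (_ : [set d | _] = succn @` [set: nat])%classic.
  rewrite gen_series_image; last by move=> x y _ _ [].
  by apply: eq_gen_series => // d _ /=; rewrite mulnS addnC.
by apply/seteqP; split=> [[|d]//= _|_ [d _ <-]//]; exists d.
Qed.

(** * The permutation attached to a word *)

(** The order in which the positions of the word [a] are listed; the labels
    [kap] break the ties. *)
Definition precedes N (kap : 'S_N) (a : {ffun 'I_N -> nat}) : rel 'I_N :=
  fun i j => ((a j < a i) || (a i == a j) && (kap i < kap j))%N.

Lemma precedes_irr N kap a : irreflexive (@precedes N kap a).
Proof. by move=> i; rewrite /precedes !ltnn andbF. Qed.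

Lemma precedes_trans N kap a : transitive (@precedes N kap a).
Proof. by move=> j i l; rewrite /precedes; lia. Qed.

Lemma precedes_total N kap a i j :
  i != j -> @precedes N kap a i j || @precedes N kap a j i.
Proof.
move=> ij; have : kap i != kap j :> nat.
  by apply: contra_neq ij => /val_inj/perm_inj.
by rewrite /precedes; lia.
Qed.

Lemma card_ord_lt N c : (c <= N)%N -> #|[set y : 'I_N | (y < c)%N]| = c.
Proof.
move=> le_cN; have inj_w : injective (widen_ord le_cN).
  by move=> x y /(congr1 val)/= /val_inj.
rewrite -[RHS](card_ord c) -cardsT -(card_imset _ inj_w).
apply: eq_card => y; rewrite !inE; apply/idP/imsetP => [lt_yx|[z _ ->]].
  by exists (Ordinal lt_yx); rewrite ?inE //; exact: val_inj.
exact: (ltn_ord z).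
Qed.

(** The permutation sends [i] to its rank, the number of its predecessors. *)
Lemma perm_of_strict_order N (r : rel 'I_N) :
  irreflexive r -> transitive r -> (forall i j, i != j -> r i j || r j i) ->
  exists s : 'S_N, forall i j, (s i < s j)%N = r i j.
Proof.
move=> irr tr tot; pose rk i := #|[set l | r l i]|.
have rk_homo i j : r i j -> (rk i < rk j)%N.
  move=> rij; apply: proper_card; apply/properP; split.
    by apply/fintype.subsetP => l; rewrite !inE => /tr; apply.
  by exists i; rewrite !inE // irr.
have rk_mono i j : (rk i < rk j)%N = r i j.
  apply/idP/idP => [lt_ij|/rk_homo//].
  have [ij|/tot/orP[//|/rk_homo]] := eqVneq i j.
    by rewrite ij ltnn in lt_ij.
  by rewrite ltnNge ltnW.
have rk_lt i : (rk i < N)%N.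
  rewrite -[X in (_ < X)%N](card_ord N) -cardsT; apply: proper_card.
  by apply/properP; split; [apply/fintype.subsetP|exists i; rewrite !inE ?irr].
have inj_rk : injective (fun i => Ordinal (rk_lt i)).
  move=> i j [eq_ij]; apply/eqP/negPn/negP => /tot.
  by rewrite -!rk_mono eq_ij ltnn.
by exists (perm inj_rk) => i j; rewrite !permE /= rk_mono.
Qed.

(** [s i] is the rank of position [i], so that [s^-1] lists the positions in the
    order [precedes kap a]. *)
Definition reads N (kap : 'S_N) (s : 'S_N) (a : {ffun 'I_N -> nat}) : Prop :=
  forall i j, (s i < s j)%N = precedes kap a i j.

Lemma reads_exists N (kap : 'S_N) a : exists s, reads kap s a.
Proof.
apply: perm_of_strict_order.
- exact: precedes_irr.
- exact: precedes_trans.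
- exact: precedes_total.
Qed.

Lemma reads_unique N (kap : 'S_N) s t a :
  reads kap s a -> reads kap t a -> s = t.
Proof.
move=> sa ta; apply/permP => i; apply: val_inj.
have E (u : 'S_N) :
    reads kap u a -> u i = #|[set j | precedes kap a j i]| :> nat.
  move=> ua; rewrite -[LHS](card_ord_lt (ltnW (ltn_ord _))).
  rewrite -[RHS](card_imset _ (@perm_inj _ u)).
  apply: eq_card => y; rewrite !inE; apply/idP/imsetP => [lt_y|[j]].
    by exists (u^-1 y)%g; rewrite ?permKV // inE -ua permKV.
  by rewrite inE -ua => ? ->.
exact: etrans (E s sa) (esym (E t ta)).
Qed.

(** As [precedes] is transitive and total, it suffices to compare consecutive
    positions of the list; this is what brings in descents. *)
Lemma reads_adjacent N (kap : 'S_N) s a :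
  reads kap s a <->
  forall x y : 'I_N, y = x.+1 :> nat -> precedes kap a (s^-1 x)%g (s^-1 y)%g.
Proof.
split=> [sa x y xy|adj]; first by rewrite -sa !permKV xy.
have mono (x y : 'I_N) : (x < y)%N -> precedes kap a (s^-1 x)%g (s^-1 y)%g.
  case: y => y; elim: y => // y IHy lt_yN; rewrite [(_ < _)%N]/= ltnS leq_eqVlt.
  have lt_yN' := ltnW lt_yN.
  case/orP => [/eqP xy|lt_xy]; first by apply: adj; rewrite /= xy.
  by apply: precedes_trans (IHy lt_yN' lt_xy) _; exact: adj.
have homo i j : (s i < s j)%N -> precedes kap a i j.
  by move/mono; rewrite !permK.
move=> i j; apply/idP/idP => [/homo//|pij].
have [/homo pji|//|/val_inj/perm_inj ji] := ssrnat.ltngtP (s j) (s i).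
  by have := precedes_trans pij pji; rewrite precedes_irr.
by move: pij; rewrite ji precedes_irr.
Qed.

(** * Words with a given permutation *)

Definition descent N (t : 'S_N) (x : 'I_N) : bool :=
  [exists y : 'I_N, (y == x.+1 :> nat) && (t y < t x)%N].

(** The letter at rank [x] of the word with gaps [d]: each rank [y >= x] adds
    its free gap [d y] and one more unit if a strict drop is forced there. *)
Definition tail_sum N (t : 'S_N) (d : {ffun 'I_N -> nat}) (x : nat) : nat :=
  (\sum_(y < N | x <= y) (d y + descent t y))%N.

Lemma tail_sumS N (t : 'S_N) d (x : 'I_N) :
  (tail_sum t d x = d x + descent t x + tail_sum t d x.+1)%N.
Proof.
rewrite /tail_sum (bigD1 x) //=; congr addn; apply: eq_bigl => y.
by rewrite ltn_neqAle andbC eq_sym.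
Qed.

Lemma tail_sum_out N (t : 'S_N) d : tail_sum t d N = 0%N.
Proof. by rewrite /tail_sum big_pred0 // => y; rewrite leqNgt ltn_ord. Qed.

Definition word_of_gaps N (kap s : 'S_N) (d : {ffun 'I_N -> nat}) :
    {ffun 'I_N -> nat} :=
  [ffun i => tail_sum (s^-1 * kap)%g d (s i)].

Lemma word_of_gapsE N (kap s : 'S_N) d x :
  word_of_gaps kap s d (s^-1 x)%g = tail_sum (s^-1 * kap)%g d x.
Proof. by rewrite ffunE permKV. Qed.

Lemma word_of_gaps_inj N (kap s : 'S_N) : injective (word_of_gaps kap s).
Proof.
move=> d e /ffunP de; apply/ffunP => x.
have T y : (y <= N)%N ->
    tail_sum (s^-1 * kap)%g d y = tail_sum (s^-1 * kap)%g e y.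
  rewrite leq_eqVlt => /orP[/eqP->|lt_y]; first by rewrite !tail_sum_out.
  by have := de (s^-1 (Ordinal lt_y))%g; rewrite !word_of_gapsE.
have := T x (ltnW (ltn_ord x)).
by rewrite !tail_sumS (T x.+1 (ltn_ord x)) => /addIn/addIn.
Qed.

(** Without a descent at [x] the next letter may be equal, and then the labels
    are in increasing order, as the tie-breaking rule demands. *)
Lemma reads_word_of_gaps N (kap s : 'S_N) d :
  reads kap s (word_of_gaps kap s d).
Proof.
apply/reads_adjacent => x y xy.
rewrite /precedes !word_of_gapsE (tail_sumS _ _ x) -xy.
case: (boolP (descent _ x)) => [_|]; first by apply/orP; left; lia.
rewrite negb_exists => /forallP/(_ y).
rewrite xy eqxx /= -leqNgt !permM leq_eqVlt.
case/orP => [/eqP/val_inj/perm_inj/perm_inj yx|lt_xy].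
  by move: xy; rewrite yx; lia.
by rewrite lt_xy; lia.
Qed.

(** The gaps are the differences of consecutive letters of the list, less the
    forced drops; the list is continued by 0, which makes the last letter a
    gap too. *)
Lemma word_of_gaps_onto N (kap s : 'S_N) a :
  reads kap s a -> exists d, word_of_gaps kap s d = a.
Proof.
move=> /reads_adjacent adj; set t := (s^-1 * kap)%g.
pose g (x : nat) := (if insub x is Some y then a (s^-1 y)%g else 0)%N.
have gE (x : 'I_N) : g x = a (s^-1 x)%g by rewrite /g valK.
have gN : g N = 0%N by rewrite /g insubN // ltnn.
have g_le (x : 'I_N) : (descent t x + g x.+1 <= g x)%N.
  case: (ltnP x.+1 N) => [lt_xN|le_Nx]; last first.
    have -> : x.+1 = N by apply/eqP; rewrite eqn_leq le_Nx ltn_ord.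
    rewrite gN /descent; case: existsP => // -[y /andP[/eqP yx _]].
    by have := ltn_ord y; rewrite yx; lia.
  have := adj x (Ordinal lt_xN) erefl.
  rewrite -[x.+1]/(nat_of_ord (Ordinal lt_xN)) !gE /precedes /descent.
  case: existsP => [[y /andP[/eqP yx]]|_] /=; last by lia.
  have -> : y = Ordinal lt_xN by exact: val_inj.
  by rewrite !permM; lia.
exists [ffun x : 'I_N => (g x - g x.+1 - descent t x)%N]; apply/ffunP => i.
rewrite -[i](permK s) word_of_gapsE -gE.
have le_N := ltnW (ltn_ord (s i)); move: (nat_of_ord _) le_N => x le_xN.
(* The tail sums telescope from the end, so the induction is on [N - x]. *)
rewrite -(subKn le_xN); elim: (N - x)%N => [|c IHc].
  by rewrite subn0 tail_sum_out gN.
case: (ltnP c N) => [lt_cN|le_Nc]; last first.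
  by move: IHc; rewrite (_ : N - c.+1 = N - c)%N //; lia.
have lt_N : (N - c.+1 < N)%N by lia.
have eN : (N - c.+1).+1 = (N - c)%N by lia.
have := g_le (Ordinal lt_N).
rewrite (tail_sumS _ _ (Ordinal lt_N)) ffunE /= eN IHc -/t => le_g.
by rewrite -subnDA (addnC (g _)) -addnA subnK.
Qed.

(** The gap and the drop at rank [y] (counted from 0) are shared by the [y + 1]
    letters of rank at most [y]; the drops thus add up to the major index. *)
Lemma sum_word_of_gaps N (kap s : 'S_N) d :
  (\sum_i word_of_gaps kap s d i =
   \sum_(x < N) x.+1 * d x + maj (s^-1 * kap)%g)%N.
Proof.
rewrite (reindex_inj (@perm_inj _ (s^-1)%g)) /=.
under eq_bigr do rewrite word_of_gapsE.
transitivity (\sum_(y < N) y.+1 * (d y + descent (s^-1 * kap)%g y))%N.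
  rewrite /tail_sum (exchange_big_dep xpredT) //=; apply: eq_bigr => y _.
  rewrite sum_nat_const; congr muln.
  by rewrite -[RHS](card_ord_lt (ltn_ord y)); apply: eq_card => z; rewrite inE.
rewrite /maj [X in (_ = _ + X)%N]big_mkcond -big_split.
apply: eq_bigr => y _ /=; rewrite mulnDr -/(descent _ y); congr addn.
by case: descent; rewrite (muln1, muln0).
Qed.

Lemma reads_image N (kap s : 'S_N) :
  (reads kap s = word_of_gaps kap s @`
    [set d : {ffun 'I_N -> nat} | forall i, [set: nat] (d i)])%classic.
Proof.
apply/seteqP; split=> [a /word_of_gaps_onto[d <-]|a [d _ <-]].
  by exists d.
exact: reads_word_of_gaps.
Qed.

Lemma gaps_series N :
  let E := [set d : {ffun 'I_N -> nat} | forall i, [set: nat] (d i)]%classic in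
  let wE := fun d : {ffun 'I_N -> nat} => (\sum_(x < N) x.+1 * d x)%N in
  finite_levels E wE /\
  count_series E wE = \prod_(x < N) (1 - q ^+ x.+1)^-1.
Proof.
have [|finE cE] := @count_series_ffun _ N (fun=> [set: nat]%classic)
    (fun x d => x.+1 * d)%N.
  by move=> i; exact: finite_levels_mulnat.
split=> //; apply: etrans cE _.
by apply: eq_bigr => x _; rewrite count_series_mulnat.
Qed.

Lemma finite_levels_reads N (kap s : 'S_N) :
  finite_levels (reads kap s) (fun a : {ffun 'I_N -> nat} => \sum_i a i)%N.
Proof.
rewrite reads_image; apply: finite_levels_image.
rewrite (_ : _ \o _ = fun d : {ffun 'I_N -> nat} =>
    \sum_(x < N) x.+1 * d x + maj (s^-1 * kap)%g)%N.
  by apply: finite_levels_shift; have [] := gaps_series N.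
by apply/funext => d; exact: sum_word_of_gaps.
Qed.

Lemma count_series_reads N (kap s : 'S_N) :
  count_series (reads kap s) (fun a : {ffun 'I_N -> nat} => \sum_i a i)%N =
  q ^+ maj (s^-1 * kap)%g * \prod_(x < N) (1 - q ^+ x.+1)^-1.
Proof.
rewrite reads_image /count_series gen_series_image; last first.
  by move=> d e _ _; exact: word_of_gaps_inj.
have [_ <-] := gaps_series N; rewrite -count_series_shift.
by apply: eq_gen_series => // d _; exact: sum_word_of_gaps.
Qed.

(** * Alternating words *)

Definition alternating_ffun m (a : {ffun 'I_(m.*2.+1) -> nat}) : Prop :=
  forall i j : 'I_(m.*2.+1), j = i.+1 :> nat ->
    if odd i then (a i <= a j)%N else (a j <= a i)%N.

Lemma kappaE m (i : 'I_(m.*2.+1)) :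
  kappa m i = (if odd i then i.+1 else i.-1) :> nat.
Proof.
by rewrite permE /kappa_fun inordK //; have := ltn_ord i; case: ifP; lia.
Qed.

(** At each pair of neighbours, the position of the weakly larger letter has the
    smaller label under [kappa], so ties are listed in the order that [Ralt]
    prescribes. *)
Lemma Ralt_reads m (s : 'S_(m.*2.+1)) a :
  reads (kappa m) s a -> (s \in Ralt m) <-> alternating_ffun a.
Proof.
move=> sa; rewrite inE.
have key (i j : 'I_(m.*2.+1)) : j = i.+1 :> nat ->
    (if odd i then s j < s i else s i < s j)%N =
    (if odd i then a i <= a j else a j <= a i)%N.
  move=> ij; case: ifP => oi; rewrite sa /precedes !kappaE ij /= oi /=;
    case: (ltngtP (a i) (a j)) => //= _; lia.
split=> [/forallP alt i j ij|alt].
  by have /forallP/(_ j) := alt i; rewrite ij eqxx /= key // ; case: ifP.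
apply/forallP => i; apply/forallP => j; apply/implyP => /eqP ij.
by rewrite key //; have := alt i j ij; case: ifP.
Qed.

Lemma alternating_ffun_series m :
  let w := fun a : {ffun 'I_(m.*2.+1) -> nat} => (\sum_i a i)%N in
  finite_levels (@alternating_ffun m) w /\
  count_series (@alternating_ffun m) w = Estar_tilde m.
Proof.
move=> w.
have altE : @alternating_ffun m =
    [set a | exists2 s, s \in Ralt m & reads (kappa m) s a]%classic.
  apply/seteqP; split=> [a alt|a [s sR sa]]; last first.
    exact: (proj1 (Ralt_reads sa) sR).
  have [s sa] := reads_exists (kappa m) a.
  exists s; last exact: sa.
  exact: (proj2 (Ralt_reads sa) alt).
split.
  move=> N; rewrite altE.
  apply: (@sub_finite_set _ _ (\bigcup_(s in [set: 'S_(m.*2.+1)])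
    [set a | reads (kappa m) s a /\ w a = N])%classic).
    by move=> a [[s _ sa] wa]; exists s.
  apply: bigcup_finite => [|s _]; first exact: finite_finset.
  exact: finite_levels_reads.
rewrite altE /count_series gen_series_partition; last 2 first.
- by move=> s _; exact: finite_levels_reads.
- by move=> s t a _ _; exact: reads_unique.
rewrite /Estar_tilde big_add1 big_mkord -prodrV => [|i _]; last first.
  exact: unit_one_subXn.
rewrite mulr_suml; apply: eq_bigr => s _; exact: count_series_reads.
Qed.

Definition alternating_words m : set (seq nat) :=
  [set w | alternating_word w /\ size w = m.*2.+1]%classic.

Definition seq_of_ffun n (a : {ffun 'I_n.+1 -> nat}) : seq nat :=
  mkseq (fun t => a (inord t)) n.+1.

Lemma seq_of_ffun_inj n : injective (@seq_of_ffun n).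
Proof.
move=> a b /(congr1 (fun u => nth 0%N u)) eq_ab; apply/ffunP => i.
by have := congr1 (@^~ (val i)) eq_ab; rewrite !nth_mkseq //= inord_val.
Qed.

Lemma sumn_seq_of_ffun n (a : {ffun 'I_n.+1 -> nat}) :
  sumn (seq_of_ffun a) = (\sum_i a i)%N.
Proof.
rewrite sumnE big_map -[iota 0 n.+1]/(index_iota 0 n.+1) big_mkord.
by apply: eq_bigr => i _; rewrite inord_val.
Qed.

Lemma alternating_words_image m :
  (alternating_words m = @seq_of_ffun m.*2 @` @alternating_ffun m)%classic.
Proof.
apply/seteqP; split=> [u [alt szu]|_ [a alt <-]].
  have szE i : (i < m.*2.+1)%N -> (i < size u)%N by rewrite szu.
  exists [ffun i : 'I_m.*2.+1 => nth 0%N u i].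
    by move=> i j ij; rewrite !ffunE ij; apply: alt; rewrite szE // -ij.
  apply: (@eq_from_nth _ 0%N); rewrite size_mkseq // => i lt_i.
  by rewrite nth_mkseq // ffunE inordK.
split; last by rewrite size_mkseq.
move=> i; rewrite size_mkseq => lt_i; rewrite !nth_mkseq //; last exact: ltnW.
have lt_i' := ltnW lt_i.
by have := alt (inord i) (inord i.+1); rewrite !inordK //; apply.
Qed.

Lemma finite_levels_alternating_words m :
  finite_levels (alternating_words m) sumn.
Proof.
rewrite alternating_words_image; apply: finite_levels_image.
rewrite (_ : _ \o _ = fun a : {ffun 'I_m.*2.+1 -> nat} => \sum_i a i)%N.
  by have [] := alternating_ffun_series m.
by apply/funext => a; exact: sumn_seq_of_ffun.
Qed.

Lemma count_series_alternating_words m :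
  count_series (alternating_words m) sumn = Estar_tilde m.
Proof.
rewrite alternating_words_image /count_series gen_series_image; last first.
  by move=> a b _ _; exact: seq_of_ffun_inj.
have [_ <-] := alternating_ffun_series m.
by apply: eq_gen_series => // a _; exact: sumn_seq_of_ffun.
Qed.

(** * The sign of a permutation by inversions *)

Lemma sg_prod (R : realDomainType) (I : Type) (r : seq I) (P : pred I)
    (F : I -> R) :
  Num.sg (\prod_(i <- r | P i) F i) = \prod_(i <- r | P i) Num.sg (F i).
Proof. by apply: (big_morph _ (@sgrM R)); exact: sgr1. Qed.

(** Permuting by [s] the points [0, ..., k - 1] multiplies their Vandermonde
    determinant by the sign of [s]. The determinant is the product of the
    differences, which is positive before the permutation and has one negative
    factor per inversion after it. *)
Lemma sign_inversions k (sigma : 'I_k -> int) (s : 'S_k) :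
  (forall i j, (sigma i < sigma j) = (s i < s j)%N) ->
  (-1) ^+ inversions sigma = (-1) ^+ (s : bool) :> int.
Proof.
move=> sigmaE; pose x : 'rV[int]_k := \row_j j%:Z.
pose y : 'rV[int]_k := \row_j (s j)%:Z.
have detE : \det (Vandermonde k y) =
    (-1) ^+ (s : bool) * \det (Vandermonde k x).
  rewrite (_ : Vandermonde k y = col_perm s (Vandermonde k x)).
    by rewrite col_permE det_mulmx det_perm odd_permV mulrC.
  by apply/matrixP => i j; rewrite !mxE.
have := congr1 Num.sg detE; rewrite sgrM sgrX sgrN1 !det_Vandermonde.
rewrite (_ : Num.sg (\prod_i \prod_(j | _) (x 0 j - x 0 i)) = 1) ?mulr1;
  last first.
  rewrite sg_prod big1 // => i _; rewrite sg_prod big1 // => j lt_ij.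
  by rewrite !mxE gtr0_sg // subr_gt0 ltz_nat.
move=> <-; rewrite sg_prod.
under [RHS]eq_bigr do rewrite sg_prod.
rewrite pair_big_dep /= /inversions -prodr_const.
under [LHS]eq_bigl do rewrite inE.
rewrite big_mkcondr; apply: eq_bigr => -[i j] /= lt_ij; rewrite !mxE sigmaE.
case: (ssrnat.ltngtP (s j) (s i)) => [lt_s|lt_s|/val_inj/perm_inj ji].
- by rewrite ltr0_sg // subr_lt0 ltz_nat.
- by rewrite gtr0_sg // subr_gt0 ltz_nat.
- by rewrite ji ltnn in lt_ij.
Qed.

(** * Staircase arrays *)

(** The columns of an array are determined: the last entry of row [i] is in
    column [2 i]. *)
Definition place_rows k (u : {ffun 'I_k -> seq nat}) : placed_rows k :=
  [ffun i : 'I_k => ((2 * i)%N%:Z, u i)].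

Lemma place_rows_inj k : injective (@place_rows k).
Proof.
by move=> u v /ffunP uv; apply/ffunP => i; have := uv i; rewrite !ffunE => -[].
Qed.

Definition rows_of_perm (n k : nat) (s : 'S_k) : set {ffun 'I_k -> seq nat} :=
  [set u | forall i : 'I_k, alternating_words (n + i + s i) (u i)]%classic.

Definition arrays_of_perm (n k : nat) (s : 'S_k) : set (placed_rows k) :=
  (@place_rows k @` rows_of_perm n s)%classic.

Lemma row_excess_of_perm n k (s : 'S_k) P i :
  arrays_of_perm n s P -> row_excess P i = (2 * n + 2 * s i + 1)%N%:Z.
Proof. by case=> u us <-; rewrite /row_excess ffunE /= (us i).2; lia. Qed.

Lemma assoc_perm_of_perm n k (s : 'S_k) P i :
  arrays_of_perm n s P -> assoc_perm n P i = (s i).+1%:Z.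
Proof.
move=> Ps; rewrite /assoc_perm (row_excess_of_perm _ Ps).
rewrite (_ : _ + 1 = (s i).+1%:Z * 2) ?mulzK //; lia.
Qed.

Lemma arrays_of_perm_inj n k (s t : 'S_k) P :
  arrays_of_perm n s P -> arrays_of_perm n t P -> s = t.
Proof.
move=> Ps Pt; apply/permP => i; apply: val_inj => /=.
by have := assoc_perm_of_perm i Ps; rewrite (assoc_perm_of_perm i Pt) => -[].
Qed.

(** The order condition says that [row_excess] maps the [k] rows onto the [k]
    prescribed values, so it is a bijection, and [s] is its description. *)
Lemma arrays_of_orderE n k :
  @arrays_of_order n k =
  [set P | exists2 s : 'S_k, xpredT s & arrays_of_perm n s P]%classic.
Proof.
apply/seteqP; split=> P; last first.
  move=> [s _ Ps]; have exE := row_excess_of_perm _ Ps; split.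
    case: Ps => u us <-; split=> [i|i j ij|i i0]; rewrite !ffunE /=.
    - by have [alt sz] := us i; split=> // u0; rewrite u0 in sz.
    - by rewrite ij; lia.
    - by rewrite i0.
  apply/seteqP; split=> z [i _ <-].
    by exists (s i) => //; rewrite exE.
  by exists (s^-1 i)%g => //; rewrite exE permKV.
case=> stP ordP.
have ex_row i : exists j : 'I_k, row_excess P i == (2 * n + 2 * j + 1)%N%:Z.
  have : [set row_excess P i | i in [set: 'I_k]]%classic (row_excess P i).
    by exists i.
  by rewrite ordP => -[j _ jE]; exists j; rewrite jE.
pose f i := xchoose (ex_row i).
have fE i : row_excess P i = (2 * n + 2 * f i + 1)%N%:Z.
  by apply/eqP; exact: xchooseP (ex_row i).
have f_onto j : exists i, f i == j.
  have : [set (2 * n + 2 * j + 1)%N%:Z | j in [set: 'I_k]]%classic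
    ((2 * n + 2 * j + 1)%N%:Z : int) by exists j.
  rewrite -ordP => -[i _]; rewrite fE => eq_ij.
  by exists i; apply/eqP/val_inj => /=; lia.
(* [f] is onto; its section [g] is injective on a finite set, so a
   permutation, and [f] is the inverse of [g]. *)
pose g j := xchoose (f_onto j).
have fg j : f (g j) = j by apply/eqP; exact: xchooseP (f_onto j).
pose s := perm (can_inj fg).
have fs i : f i = (s^-1 i)%g by rewrite -{1}[i](permKV s) permE fg.
exists (s^-1)%g => //; exists [ffun i => (P i).2]; last first.
  apply/ffunP => i; rewrite !ffunE -(staircase_last_col i stP).
  by rewrite -surjective_pairing.
move=> i; rewrite ffunE; split; first by case: stP => /(_ i)[].
by have := fE i; rewrite /row_excess -fs; lia.
Qed.

Lemma array_weight_place_rows k (u : {ffun 'I_k -> seq nat}) :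
  array_weight (place_rows u) = (\sum_(i < k) sumn (u i))%N.
Proof. by apply: eq_bigr => i _; rewrite ffunE. Qed.

Lemma rows_of_perm_series n k (s : 'S_k) :
  let w := fun u : {ffun 'I_k -> seq nat} => (\sum_(i < k) sumn (u i))%N in
  finite_levels (rows_of_perm n s) w /\
  count_series (rows_of_perm n s) w = \prod_(i < k) Estar_tilde (n + i + s i).
Proof.
have [|fin cE] := @count_series_ffun _ k
    (fun i => alternating_words (n + i + s i)) (fun=> sumn).
  by move=> i; exact: finite_levels_alternating_words.
split=> //; apply: etrans cE _; apply: eq_bigr => i _.
exact: count_series_alternating_words.
Qed.

Lemma finite_levels_arrays_of_perm n k (s : 'S_k) :
  finite_levels (arrays_of_perm n s) (@array_weight k).
Proof.
apply: finite_levels_image; have -> : @array_weight k \o @place_rows k =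
    fun u : {ffun 'I_k -> seq nat} => (\sum_(i < k) sumn (u i))%N.
  by apply/funext => u; exact: array_weight_place_rows.
by have [] := rows_of_perm_series n s.
Qed.

Lemma gen_series_arrays_of_perm n k (s : 'S_k) :
  gen_series (arrays_of_perm n s) (@array_sgn n k) (@array_weight k) =
  (-1) ^+ (s : bool) * \prod_(i < k) Estar_tilde (n + i + s i).
Proof.
have [_ <-] := rows_of_perm_series n s; rewrite -gen_series_sign.
rewrite (eq_gen_series (s' := fun=> (-1) ^+ (s : bool))
  (w' := @array_weight k)) //.
  rewrite gen_series_image; last by move=> u v _ _; exact: place_rows_inj.
  by apply: eq_gen_series => // u _; exact: array_weight_place_rows.
move=> P Ps; apply: sign_inversions => i j.
by rewrite !(assoc_perm_of_perm _ Ps) ltz_nat ltnS.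
Qed.

(* With i, j counted from 0, the index 2(n + (i+1) + (j+1)) - 3 of the entry is
   2(n + i + j) + 1. *)
Theorem theorem2p1 (n k : nat) (n_gt0 : (0 < n)%N) (k_gt0 : (0 < k)%N) :
  gen_series (@arrays_of_order n k) (@array_sgn n k) (@array_weight k) =
  \det (\matrix_(i < k, j < k) Estar_tilde (n + i + j)).
Proof.
rewrite arrays_of_orderE gen_series_partition; last 2 first.
- by move=> s _; exact: finite_levels_arrays_of_perm.
- by move=> s t P _ _; exact: arrays_of_perm_inj.
apply: eq_bigr => s _; rewrite gen_series_arrays_of_perm; congr (_ * _).
by apply: eq_bigr => i _; rewrite mxE.
Qed.
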